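(* For $\bm{\eta}=(\alpha,\beta,\mu,\kappa,\lambda)^T$ let $$f_{\mathrm{AL}}(\theta,x|\bm{\eta})=\frac{\alpha\beta^\alpha}{2\pi\cosh(\kappa)}\{1+\lambda\sin(\theta-\mu)\}\,x^{\alpha-1}\exp\left[-(\beta x)^\alpha\{1-\tanh(\kappa)\cos(\theta-\mu)\}\right]$$ be the density of a cylindrical distribution of a pair $(\Theta,X)$, and let $\Gamma_{\mathrm{AL}}=\{(\alpha,\beta,\mu,\kappa,\lambda)^T\mid\alpha>0,\ \beta>0,\ 0\le\mu<2\pi,\ \kappa>0,\ -1\le\lambda\le1\}$. Then the family $\{f_{\mathrm{AL}}(\theta,x|\bm{\eta})\mid\bm{\eta}\in\Gamma_{\mathrm{AL}}\}$ is identifiable.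
   Context: Here $\theta\in[-\pi,\pi)$ (identified with the unit circle) and $x$ ranges over the non-negative real line, and the density is with respect to Lebesgue measure $d\theta\,dx$. Identifiability: a family $\{f(\cdot|\bm{\eta})\mid\bm{\eta}\in\Gamma\}$ of densities is identifiable if $\bm{\eta}_1\neq\bm{\eta}_2$ in $\Gamma$ implies that $f(\cdot|\bm{\eta}_1)$ and $f(\cdot|\bm{\eta}_2)$ define different distributions (different cumulative distribution functions; equivalently, the densities are not equal almost everywhere). *)

(* Defs.v *)
From mathcomp Require Import all_boot all_order all_algebra.
From mathcomp Require Import all_classical all_reals all_analysis.

Set Implicit Arguments.
Unset Strict Implicit.
Unset Printing Implicit Defensive.

Import Order.TTheory GRing.Theory Num.Theory.
Import numFieldNormedType.Exports.

Local Open Scope classical_set_scope.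
Local Open Scope ring_scope.

Section hyperbolic.
Context {R : realType}.
Implicit Types x : R.

Definition cosh x : R := (expR x + expR (- x)) / 2.
Definition sinh x : R := (expR x - expR (- x)) / 2.
Definition tanh x : R := sinh x / cosh x.

End hyperbolic.

Section cylindrical.
Context {R : realType}.

(* The circle is represented by the fundamental domain [-pi, pi). *)
Definition cylinder : set (R * R) := `[- pi, pi[ `*` `[0, +oo[.

Definition cyl_distribution (f : R -> R -> R) (A : set (R * R)) : \bar R :=
  (\int[(@lebesgue_measure R \x @lebesgue_measure R)%E]_(z in cylinder `&` A)
    (f z.1 z.2)%:E)%E.

(* Angles are ordered by their representatives in [-pi, pi), so for
   (t, y) in the cylinder this is the mass of [-pi, t] x [0, y]. *)
Definition cyl_cdf (f : R -> R -> R) (t y : R) : \bar R :=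
  cyl_distribution f (`]-oo, t] `*` `]-oo, y]).

Definition identifiable (P : Type) (Gamma : set P) (f : P -> R -> R -> R) :=
  forall eta1 eta2, Gamma eta1 -> Gamma eta2 ->
    eta1 <> eta2 -> cyl_cdf (f eta1) <> cyl_cdf (f eta2).

End cylindrical.

Record AL_param (R : realType) := ALParam {
  AL_alpha : R;
  AL_beta : R;
  AL_mu : R;
  AL_kappa : R;
  AL_lambda : R
}.

Section abe_ley.
Context {R : realType}.

Definition Gamma_AL : set (AL_param R) :=
  [set eta | [/\ 0 < AL_alpha eta, 0 < AL_beta eta,
                 0 <= AL_mu eta < 2 * pi, 0 < AL_kappa eta
               & -1 <= AL_lambda eta <= 1]].

Definition f_AL (eta : AL_param R) (theta x : R) : R :=
  let: ALParam alpha beta mu kappa lambda := eta in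
  alpha * beta `^ alpha / (2 * pi * cosh kappa)
  * (1 + lambda * sin (theta - mu))
  * x `^ (alpha - 1)
  * expR (- ((beta * x) `^ alpha * (1 - tanh kappa * cos (theta - mu)))).

End abe_ley.

(* Main.v *)
Require Import Defs.
From mathcomp Require Import all_boot all_order all_algebra.
From mathcomp Require Import all_classical all_reals all_analysis.
From mathcomp Require Import measurable_realfun ring lra.

(** Both densities are continuous for x > 0 and have a finite distribution
    function, so equality of the distribution functions forces equality of the
    masses of all small rectangles, hence pointwise equality of the densities on
    [- pi, pi[ times ]0, +oo[ ([cdf_density_eq]).

    At a fixed angle theta the density has the form
      A * x^(alpha - 1) * exp (- B * x^alpha),
    and if A > 0 the function of x determines alpha, A and B ([weibull_inj]): as
    x tends to 0 it behaves like A * x^(alpha - 1), and then the value at x = 1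
    gives B.  So alpha is determined, and so are, at every angle where the density
    does not vanish, the amplitude A, proportional to
    1 + lambda * sin (theta - mu), and the rate
    B = beta^alpha * (1 - tanh kappa * cos (theta - mu)).

    The rate is a trigonometric polynomial of degree 1, determined by its values
    at three suitable angles.  Its mean is beta^alpha; its oscillating part has
    the positive amplitude beta^alpha * tanh kappa and the phase mu.  As kappa > 0
    this gives beta, kappa and mu.  Finally A gives lambda ([AL_param_eq]). *)

Set Implicit Arguments.
Unset Strict Implicit.
Unset Printing Implicit Defensive.

Import Order.TTheory GRing.Theory Num.Theory.
Import numFieldNormedType.Exports.

Local Open Scope classical_set_scope.
Local Open Scope ring_scope.

(** * Continuous densities and distribution functions on the cylinder *)

Section cdf_determines_density.
Context {R : realType}.
Local Notation mu2 := (@lebesgue_measure R \x @lebesgue_measure R)%E.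
Implicit Types (f g : R -> R -> R) (A B : set (R * R)).

Lemma fin_num_addeI (x y z : \bar R) : x \is a fin_num ->
  (x + y = x + z)%E -> y = z.
Proof. by move=> xfin E; rewrite -(addeK y xfin) (addeC y) E (addeC x) addeK. Qed.

Lemma measurable_cylinder : measurable (@cylinder R).
Proof. exact: measurableX. Qed.

Definition cyl_density f :=
  [/\ measurable_fun setT (fun z : R * R => f z.1 z.2),
      forall t x, cylinder (t, x) -> 0 <= f t x
    & forall t y, (cyl_cdf f t y < +oo)%E].

Lemma cyl_distributionU f A B :
    measurable_fun setT (fun z : R * R => f z.1 z.2) ->
    (forall t x, cylinder (t, x) -> 0 <= f t x) ->
    measurable A -> measurable B -> [disjoint A & B] ->
  (cyl_distribution f (A `|` B) = cyl_distribution f A + cyl_distribution f B)%E.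
Proof.
move=> mf f0 mA mB AB; rewrite /cyl_distribution setIUr.
have mC := measurable_cylinder.
apply: ge0_integral_setU.
- exact: measurableI.
- exact: measurableI.
- by apply/measurable_EFinP; exact: measurable_funS mf.
- by move=> [t x] [[c _]|[c _]]; rewrite lee_fin; exact: f0.
- by move: AB; rewrite !disj_set2E setIACA setIid => /eqP ->; rewrite setI0.
Qed.

(** Inclusion-exclusion: the mass of a rectangle is an alternating sum of four
    values of the distribution function.  Finiteness is what allows these
    values to be cancelled; it is used in additive form, cutting off first the
    strip over ]a, b] and then the rectangle inside that strip. *)
Lemma cyl_distribution_rect f g (a b c d : R) : a < b -> c < d ->
    cyl_density f -> cyl_density g ->
    cyl_cdf f = cyl_cdf g ->
  cyl_distribution f (`]a, b] `*` `]c, d]) =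
  cyl_distribution g (`]a, b] `*` `]c, d]).
Proof.
move=> ab cd [mf f0 ffin] [mg g0 _] fg.
have itvU (u v : R) : u < v -> `]-oo, v]%classic = `]-oo, u] `|` `]u, v].
  move=> uv; rewrite -(@itv_bndbnd_setU _ _ -oo%O (BRight u) (BRight v)) //.
  by rewrite bnd_simp ltW.
have itvD (u v : R) : `]-oo, u] `&` `]u, v] = set0.
  apply/seteqP; split=> // x /= []; rewrite !in_itv/= => xu /andP[ux _].
  by have := lt_le_trans ux xu; rewrite ltxx.
have strip_split (h : R -> R -> R) y : measurable_fun setT (fun z : R * R => h z.1 z.2) ->
    (forall t x, cylinder (t, x) -> 0 <= h t x) ->
  (cyl_cdf h b y = cyl_cdf h a y + cyl_distribution h (`]a, b] `*` `]-oo, y]))%E.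
  move=> mh h0; rewrite /cyl_cdf (itvU _ _ ab).
  rewrite (_ : (_ `|` _) `*` _ =
    (`]-oo, a] `*` `]-oo, y]) `|` (`]a, b] `*` `]-oo, y])); last first.
    by apply/seteqP; split=> -[u v] /=; tauto.
  apply: cyl_distributionU => //; try exact: measurableX.
  by rewrite disj_set2E -setXI itvD set0X.
have rect_split (h : R -> R -> R) : measurable_fun setT (fun z : R * R => h z.1 z.2) ->
    (forall t x, cylinder (t, x) -> 0 <= h t x) ->
  (cyl_distribution h (`]a, b] `*` `]-oo, d]) =
   cyl_distribution h (`]a, b] `*` `]-oo, c]) +
   cyl_distribution h (`]a, b] `*` `]c, d]))%E.
  move=> mh h0; rewrite (itvU _ _ cd).
  rewrite (_ : _ `*` (_ `|` _) =
    (`]a, b] `*` `]-oo, c]) `|` (`]a, b] `*` `]c, d])); last first.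
    by apply/seteqP; split=> -[u v] /=; tauto.
  apply: cyl_distributionU => //; try exact: measurableX.
  by rewrite disj_set2E -setXI itvD setX0.
have D0 A : (0 <= cyl_distribution f A)%E.
  by apply: integral_ge0 => -[t x] [c0 _]; rewrite lee_fin; exact: f0.
have fnum t y : cyl_cdf f t y \is a fin_num by rewrite ge0_fin_numE ?D0.
have strip y : cyl_distribution f (`]a, b] `*` `]-oo, y]) =
    cyl_distribution g (`]a, b] `*` `]-oo, y]).
  have := strip_split f y mf f0; rewrite fg (strip_split g y mg g0) => /esym.
  by apply: fin_num_addeI; rewrite -fg.
have := rect_split f mf f0; rewrite !strip (rect_split g mg g0) => /esym.
apply: fin_num_addeI; rewrite -strip ge0_fin_numE ?D0 //.
apply: le_lt_trans (ffin b c); rewrite (strip_split f) //.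
by rewrite leeDr // D0.
Qed.

(** If f < g at a point, continuity separates the two densities by constants
    m1 < m2 on a neighbourhood, and a small rectangle in it has different masses
    under f and g.  The rectangle is taken to the upper right of the point so
    that it stays in the cylinder even when the angle is - pi. *)
Lemma cdf_density_le f g (t x : R) : - pi <= t < pi -> 0 < x ->
    cyl_density f -> cyl_density g ->
    {for (t, x), continuous (fun z : R * R => f z.1 z.2)} ->
    {for (t, x), continuous (fun z : R * R => g z.1 z.2)} ->
    cyl_cdf f = cyl_cdf g ->
  g t x <= f t x.
Proof.
move=> /andP[tpi1 tpi2] x0 df dg cf cg fg.
have [mf f0 _] := df; have [mg g0 _] := dg.
rewrite leNgt; apply/negP => fltg.
(* f t x < m1 < m2 < g t x cut the gap into three equal parts *)
pose m1 := f t x + (g t x - f t x) / 3.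
pose m2 := f t x + (g t x - f t x) / 3 * 2.
have fm : f t x < m1 by rewrite /m1; lra.
have mm : m1 < m2 by rewrite /m1 /m2; lra.
have mgx : m2 < g t x by rewrite /m2; lra.
have nf : \forall z \near (t, x), f z.1 z.2 <= m1.
  by near do apply/ltW; apply: (cvgr_lt (f t x)).
have ng : \forall z \near (t, x), m2 <= g z.1 z.2.
  by near do apply/ltW; apply: (cvgr_gt (g t x)).
have [[U V] /= [[e1 /= e10 e1P] [e2 /= e20 e2P]] UV] :
    nbhs (t, x) (fun z => f z.1 z.2 <= m1 /\ m2 <= g z.1 z.2).
  exact: filterI.
pose e := Num.min e1 e2.
have e0 : 0 < e by rewrite /e lt_min e10.
have [ee1 ee2] : e <= e1 /\ e <= e2 by rewrite /e !ge_min !lexx orbT.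
pose r := Num.min (e / 2) ((pi - t) / 2).
have r0 : 0 < r by rewrite /r lt_min; apply/andP; split; lra.
have re : r < e.
  by apply: le_lt_trans (_ : e / 2 < e); [rewrite /r ge_min lexx|lra].
have rpi : t + r < pi.
  have : r <= (pi - t) / 2 by rewrite /r ge_min lexx orbT.
  lra.
pose Q : set (R * R) := `]t, t + r] `*` `]x, x + r].
have QC : Q `<=` cylinder.
  move=> [u v] [] /=; rewrite !in_itv/= => /andP[h1 h2] /andP[h3 h4].
  by split; rewrite /= in_itv/=; [apply/andP; split; lra|rewrite andbT; lra].
have QP u v : Q (u, v) -> f u v <= m1 /\ m2 <= g u v.
  move=> [] /=; rewrite !in_itv/= => /andP[h1 h2] /andP[h3 h4].
  apply: (UV (u, v)); split => /=; [apply: e1P|apply: e2P];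
    by rewrite /ball/= ltr_norml; apply/andP; split; lra.
have := @cyl_distribution_rect f g t (t + r) x (x + r).
move=> /(_ ltac:(lra) ltac:(lra) df dg fg).
rewrite /cyl_distribution setIidr//.
have mQ : measurable (Q : set (R * R)) by exact: measurableX.
have muQ : mu2 Q = (r * r)%:E.
  have muI (u : R) : @lebesgue_measure R `]u, u + r] = r%:E.
    rewrite lebesgue_measure_itv/= lte_fin ltrDl r0 -EFinD.
    by congr (_%:E); ring.
  rewrite EFinM /Q product_measure1E//; congr (_ * _)%E; exact: muI.
have m10 : 0 <= m1.
  apply: le_trans (ltW fm); apply: f0.
  by split; rewrite /= in_itv/= ?andbT; [apply/andP; split|exact: ltW].
have fle : (\int[mu2]_(z in Q) (f z.1 z.2)%:E <= (m1 * (r * r))%:E)%E.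
  apply: le_trans (_ : \int[mu2]_(z in Q) (cst m1%:E z) <= _)%E.
    apply: ge0_le_integral => //.
    - by move=> [u v] /QC c; rewrite lee_fin; exact: f0.
    - by apply/measurable_EFinP; exact: measurable_funS mf.
    - by move=> [u v] /QP[]; rewrite lee_fin.
  by rewrite integral_cst// EFinM -muQ; exact: lexx.
have leg : ((m2 * (r * r))%:E <= \int[mu2]_(z in Q) (g z.1 z.2)%:E)%E.
  apply: le_trans (_ : _ <= \int[mu2]_(z in Q) (cst m2%:E z))%E _.
    by rewrite integral_cst// EFinM -muQ; exact: lexx.
  apply: ge0_le_integral => //.
  - by move=> z _; rewrite lee_fin; lra.
  - by apply/measurable_EFinP; exact: measurable_funS mg.
  - by move=> [u v] /QP[_]; rewrite lee_fin.
move=> E; move: leg; rewrite -E => /le_trans /(_ fle).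
rewrite lee_fin ler_pM2r ?mulr_gt0// leNgt mm//.
Unshelve. all: by end_near. Qed.

(** On the circle times ]0, +oo[ continuous densities are recovered pointwise
    from the distribution function. *)
Lemma cdf_density_eq f g (t x : R) : - pi <= t < pi -> 0 < x ->
    cyl_density f -> cyl_density g ->
    {for (t, x), continuous (fun z : R * R => f z.1 z.2)} ->
    {for (t, x), continuous (fun z : R * R => g z.1 z.2)} ->
    cyl_cdf f = cyl_cdf g ->
  f t x = g t x.
Proof.
move=> tpi x0 df dg cf cg fg; apply/eqP; rewrite eq_le.
by apply/andP; split; apply: cdf_density_le.
Qed.

End cdf_determines_density.

(** * Powers and Weibull-type functions *)

Section radial.
Context {R : realType}.
Implicit Types (A a b x : R).

Lemma continuous_powR (p x : R) : 0 < x -> {for x, continuous (fun x : R => x `^ p)}.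
Proof.
move=> x0; apply: differentiable_continuous; apply/derivable1_diffP.
by apply: derivable_powR; rewrite in_itv/= andbT.
Qed.

Lemma gt0_powRD x a b : 0 < x -> x `^ (a + b) = x `^ a * x `^ b.
Proof. by move=> x0; rewrite powRD ?(gt_eqF x0) ?implybT. Qed.

(** As x tends to 0 the exponential factor disappears, so near 0 only the power
    of x and the leading constant are visible. *)
Lemma cvg_expRN_powR a b : 0 < a ->
  expR (- (b * x `^ a)) @[x --> 0^'+] --> (1 : R).
Proof.
move=> a0; rewrite -(@expR0 R).
apply: continuous_cvg; first exact: continuous_expR.
rewrite -[X in _ --> X]oppr0; apply: cvgN.
rewrite -[X in _ --> X](mulr0 b); apply: cvgMl_tmp; exact: powR_cvg0.
Qed.

(** Dividing by x^(a1 - 1), the left side tends to A1 > 0 at 0, whereas a2 > a1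
    would leave a positive power of x on the right and the limit 0. *)
Lemma weibull_exponent_ge A1 A2 a1 a2 b1 b2 : 0 < A1 -> 0 < a1 -> 0 < a2 ->
    (forall x, 0 < x -> A1 * x `^ (a1 - 1) * expR (- (b1 * x `^ a1)) =
                        A2 * x `^ (a2 - 1) * expR (- (b2 * x `^ a2))) ->
  a2 <= a1.
Proof.
move=> A10 a10 a20 E; rewrite leNgt; apply/negP => a12.
have lim1 : A1 * expR (- (b1 * x `^ a1)) @[x --> 0^'+] --> A1.
  rewrite -[X in _ --> X]mulr1; apply: cvgMl_tmp; exact: cvg_expRN_powR.
have lim2 : A2 * x `^ (a2 - a1) * expR (- (b2 * x `^ a2)) @[x --> 0^'+] --> (0 : R).
  suff: A2 * x `^ (a2 - a1) * expR (- (b2 * x `^ a2)) @[x --> 0^'+] --> A2 * 0 * 1.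
    by rewrite mulr0 mul0r.
  apply: cvgM; last exact: cvg_expRN_powR.
  by apply: cvgMl_tmp; apply: powR_cvg0; rewrite subr_gt0.
have lim2' : A1 * expR (- (b1 * x `^ a1)) @[x --> 0^'+] --> (0 : R).
  apply: cvg_trans lim2; apply: near_eq_cvg; near=> x.
  have x0 : 0 < x by near: x; exact: nbhs_right_gt.
  apply: (@mulIf _ (x `^ (a1 - 1))); first by rewrite gt_eqF// powR_gt0.
  rewrite [RHS]mulrAC E// (_ : a2 - 1 = a2 - a1 + (a1 - 1)); last by ring.
  by rewrite (gt0_powRD (a2 - a1))//; ring.
have A1E : A1 = 0 by exact: cvg_unique lim1 lim2'.
by rewrite A1E ltxx in A10.
Unshelve. all: by end_near. Qed.

(** Once the exponents agree, the limit at 0 gives the leading constant and the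
    value at 1 then gives the rate. *)
Lemma weibull_inj A1 A2 a1 a2 b1 b2 : 0 < A1 -> 0 < A2 -> 0 < a1 -> 0 < a2 ->
    (forall x, 0 < x -> A1 * x `^ (a1 - 1) * expR (- (b1 * x `^ a1)) =
                        A2 * x `^ (a2 - 1) * expR (- (b2 * x `^ a2))) ->
  [/\ a1 = a2 :> R, A1 = A2 & b1 = b2].
Proof.
move=> A10 A20 a10 a20 E.
have aE : a1 = a2.
  apply/eqP; rewrite eq_le; apply/andP; split.
    exact: (weibull_exponent_ge A20 a20 a10 (fun x hx => esym (E x hx))).
  exact: (weibull_exponent_ge A10 a10 a20 E).
move: a20 E; rewrite -aE => _ E {a2 aE}.
have AE : A1 = A2.
  have lim A b : A * expR (- (b * x `^ a1)) @[x --> 0^'+] --> A.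
    rewrite -[X in _ --> X]mulr1; apply: cvgMl_tmp; exact: cvg_expRN_powR.
  suff lim12 : A1 * expR (- (b1 * x `^ a1)) @[x --> 0^'+] --> A2.
    exact: cvg_unique (lim A1 b1) lim12.
  apply: cvg_trans (lim A2 b2); apply: near_eq_cvg; near=> x.
  have x0 : 0 < x by near: x; exact: nbhs_right_gt.
  apply: (@mulIf _ (x `^ (a1 - 1))); first by rewrite gt_eqF// powR_gt0.
  by rewrite mulrAC -E// mulrAC.
split=> //; have := E 1 ltr01.
rewrite AE !powR1 !mulr1 => /(mulfI (lt0r_neq0 A20)) /expR_inj /oppr_inj //.
Unshelve. all: by end_near. Qed.

(** For a < 1 the integrand blows up at 0.  The fundamental theorem of calculus
    on [y / (n + 2), y] bounds the integral there by y^a / a uniformly in n, and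
    monotone convergence passes to ]0, y]. *)
Lemma integral_powR_lty (a y : R) : 0 < a -> 0 < y ->
  (\int[@lebesgue_measure R]_(x in `[0%R, y]) (x `^ (a - 1))%:E < +oo)%E.
Proof.
move=> a0 y0.
have mp D : measurable_fun D (fun x : R => (x `^ (a - 1))%:E).
  by apply/measurable_EFinP; apply: measurable_funTS; exact: measurable_powR.
rewrite -integral_itv_obnd_cbnd//.
pose F n := `[y / n.+2%:R, y]%classic.
have FE : `]0, y]%classic = \bigcup_n F n.
  apply/seteqP; split => x /=; rewrite in_itv/=.
    move=> /andP[x0 xy].
    exists (Num.truncn (y / x)) => //; rewrite /F/= in_itv/= xy andbT.
    rewrite ler_pdivrMr// mulrC -ler_pdivrMr//.
    apply: le_trans (ltW (truncnS_gt _)) _; by rewrite ler_nat.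
  move=> [n _]; rewrite /F/= in_itv/= => /andP[h ->]; rewrite andbT.
  by apply: lt_le_trans h; rewrite divr_gt0.
have FTC n :
    (\int[@lebesgue_measure R]_(x in F n) (x `^ (a - 1))%:E <= (y `^ a / a)%:E)%E.
  have yn0 : 0 < y / n.+2%:R by rewrite divr_gt0.
  have pos x : y / n.+2%:R <= x -> 0 < x by move=> /(lt_le_trans yn0).
  have dP x : 0 < x -> is_derive x 1 (fun x : R => x `^ a / a) (x `^ (a - 1)).
    move=> x0; have := is_derive1_powR a x0 => d.
    have -> : (fun x : R => x `^ a / a) = a^-1 \*: (@powR R ^~ a).
      by apply/funext => z /=; rewrite /GRing.scale/= mulrC.
    apply: is_derive_eq.
    by rewrite /GRing.scale/= mulrA mulVf ?mul1r// lt0r_neq0.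
  rewrite (@continuous_FTC2 _ _ (fun x : R => x `^ a / a)).
  - by rewrite -EFinB lee_fin gerBl divr_ge0// ?powR_ge0// ltW.
  - by rewrite gtr_pMr// invf_lt1// ltr1n.
  - apply: continuous_in_subspaceT => x; rewrite inE/= in_itv/= => /andP[/pos x0 _].
    exact: continuous_powR.
  - split.
    + move=> x; rewrite in_itv/= => /andP[/ltW/pos x0 _].
      by have [] := dP x x0.
    + apply: cvg_at_right_filter; apply: cvgM; last exact: cvg_cst.
      exact: continuous_powR.
    + apply: cvg_at_left_filter; apply: cvgM; last exact: cvg_cst.
      exact: continuous_powR.
  - move=> x; rewrite in_itv/= => /andP[/ltW/pos x0 _].
    by rewrite derive1E; have [_] := dP x x0.
apply: le_lt_trans (ltry (y `^ a / a)).
rewrite FE; apply: (cvge_to_le (ge0_nondecreasing_set_cvg_integral _ _ _ _)).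
- move=> m n mn; rewrite subsetEset; apply: subset_itvr; rewrite bnd_simp.
  by rewrite ler_pM2l// lef_pV2 ?posrE// ler_nat.
- by move=> n; exact: measurable_itv.
- by move=> n; exact: mp.
- by move=> n x _; rewrite lee_fin powR_ge0.
- by apply: nearW => n; exact: FTC.
Qed.

End radial.

(** * Hyperbolic and circular functions *)

Section hyperbolic_facts.
Context {R : realType}.
Implicit Types k : R.

Lemma cosh_gt0 k : 0 < cosh k.
Proof. by rewrite divr_gt0// addr_gt0 ?expR_gt0. Qed.

(** In this form tanh depends on k through the single increasing function
    expR (2 k), from which its bounds and its injectivity can be read off. *)
Lemma tanhE k : tanh k = 1 - 2 / (expR (k + k) + 1).
Proof.
rewrite /tanh /sinh /cosh expRD expRN.
have e0 := expR_gt0 k.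
by field; apply/andP; split; rewrite gt_eqF //; nra.
Qed.

Lemma tanh_gt0 k : 0 < k -> 0 < tanh k.
Proof.
move=> k0; rewrite tanhE subr_gt0 ltr_pdivrMr ?mul1r; last first.
  by rewrite addr_gt0// expR_gt0.
have : 1 < expR (k + k) by rewrite expR_gt1 addr_gt0.
lra.
Qed.

Lemma tanh_lt1 k : tanh k < 1.
Proof. by rewrite tanhE gtrBl divr_gt0// addr_gt0// expR_gt0. Qed.

Lemma tanh_inj : injective (@tanh R).
Proof.
move=> k l; rewrite !tanhE => /addrI/oppr_inj/mulfI E.
have /invr_inj/addIr/expR_inj := E (lt0r_neq0 (ltr0Sn _ _)); lra.
Qed.

End hyperbolic_facts.

Section trig.
Context {R : realType}.

(** The window [- pi, 3 pi[ is large enough to contain m + p for all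
    0 <= m < 2 pi and - pi / 2 <= p <= pi. *)
Lemma eq_shifted_period (f g : R -> R) :
    (forall t, f (t + pi *+ 2) = f t) -> (forall t, g (t + pi *+ 2) = g t) ->
    (forall t, - pi <= t < pi -> f t = g t) ->
  forall t, - pi <= t < pi *+ 3 -> f t = g t.
Proof.
move=> fp gp fg t /andP[t1 t2]; have [tpi|pit] := ltP t pi.
  by apply: fg; rewrite t1.
rewrite -(subrK (pi *+ 2) t) fp gp; apply: fg.
by apply/andP; split; lra.
Qed.

Lemma angle_eq0 (d : R) :
  - (pi *+ 2) < d < pi *+ 2 -> sin d = 0 -> 0 < cos d -> d = 0.
Proof.
move=> /andP[d1 d2] sd cd; have pi0 := pi_gt0 R.
wlog d0 : d d1 d2 sd cd / 0 <= d.
  move=> H; have [d0|d0] := leP 0 d; first exact: H.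
  by apply: oppr_inj; rewrite oppr0; apply: H; rewrite ?sinN ?cosN ?sd ?oppr0//; lra.
apply/eqP; rewrite eq_le d0 andbT leNgt; apply/negP => dgt0.
have [dpi|] := ltP d pi.
  by have := sin_gt0_pi (x := d); rewrite dgt0 dpi sd ltxx => /(_ isT).
rewrite le_eqVlt => /predU1P[dE|pid].
  by move: cd; rewrite -dE cospi; lra.
have : 0 < sin (d - pi) by apply: sin_gt0_pi; apply/andP; split; lra.
have := sinDpi (d - pi); rewrite subrK sd => /esym/eqP.
by rewrite oppr_eq0 => /eqP ->; rewrite ltxx.
Qed.

End trig.

(** * Regularity and finite mass of the cylindrical density *)

Section integral_setX.
Local Open Scope ereal_scope.
Context d1 d2 (T1 : measurableType d1) (T2 : measurableType d2) (R : realType).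
Variables (m1 : {sigma_finite_measure set T1 -> \bar R})
          (m2 : {sigma_finite_measure set T2 -> \bar R}).

Lemma integral_setX_snd (A : set T1) (B : set T2) (h : T2 -> \bar R) :
    measurable A -> measurable B -> measurable_fun B h ->
    (forall x, B x -> 0 <= h x) ->
  \int[m1 \x m2]_(z in A `*` B) h z.2 = m1 A * \int[m2]_(x in B) h x.
Proof.
move=> mA mB mh h0.
have mhB : measurable_fun setT (h \_ B) by apply/(measurable_restrictT _ mB).1.
have hB0 x : 0 <= (h \_ B) x by exact: erestrict_ge0.
have A0 x : 0 <= (\1_A x)%:E :> \bar R by rewrite lee_fin.
have m1A : measurable_fun setT (fun x => (\1_A x)%:E : \bar R).
  by apply/measurable_EFinP; exact: measurable_indic.
rewrite integral_mkcond [in RHS]integral_mkcond.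
transitivity (\int[m1 \x m2]_z ((\1_A z.1)%:E * (h \_ B) z.2)).
  apply: eq_integral => -[u v] _ /=; rewrite !patchE indicE in_setX.
  by case: (u \in A) => /=; rewrite ?mul1e ?mul0e.
rewrite fubini_tonelli1/=; last 2 first.
- apply: emeasurable_funM; first exact: (measurableT_comp m1A measurable_fst).
  exact: (measurableT_comp mhB measurable_snd).
- by move=> z; rewrite mule_ge0.
rewrite /fubini_F/=; under eq_integral do rewrite ge0_integralZl//.
rewrite ge0_integralZr ?integral_indic ?setIT//.
by apply: integral_ge0.
Qed.

End integral_setX.

Section AL_density.
Context {R : realType}.
Implicit Types (eta : AL_param R).

Lemma skewing_ge0 (l : R) t : -1 <= l <= 1 -> 0 <= 1 + l * sin t.
Proof.
move=> /andP[l1 l2]; have s1 := sin_geN1 t; have s2 := sin_le1 t; nra.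
Qed.

Lemma rate_gt0 (k : R) t : 0 < k -> 0 < 1 - tanh k * cos t.
Proof.
move=> k0; have := tanh_gt0 k0; have := tanh_lt1 k; have := cos_le1 t.
nra.
Qed.

Lemma f_AL_const_gt0 (a b k : R) : 0 < a -> 0 < b ->
  0 < a * b `^ a / (2 * pi * cosh k).
Proof.
move=> a0 b0; have c0 := cosh_gt0 k; have p0 := pi_gt0 R.
by apply: divr_gt0; apply: mulr_gt0 => //; [exact: powR_gt0|exact: mulr_gt0].
Qed.

Lemma f_AL_ge0 eta t x : Gamma_AL eta -> 0 <= f_AL eta t x.
Proof.
case: eta => a b m k l [/= a0 b0 _ k0 l1].
apply: mulr_ge0; last exact: expR_ge0.
apply: mulr_ge0; last exact: powR_ge0.
apply: mulr_ge0; last exact: skewing_ge0.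
exact/ltW/f_AL_const_gt0.
Qed.

Lemma measurable_f_AL eta :
  measurable_fun setT (fun z : R * R => f_AL eta z.1 z.2).
Proof.
case: eta => a b m k l /=.
have mt : measurable_fun setT (fun z : R * R => z.1 - m).
  by apply: measurable_funB => //; exact: measurable_fst.
have mpow p (h : R * R -> R) : measurable_fun setT h ->
    measurable_fun setT (fun z => h z `^ p).
  by move=> mh; exact: (measurableT_comp (measurable_powR p)).
have msin : measurable_fun setT (fun z : R * R => sin (z.1 - m)).
  apply: measurableT_comp mt; apply: continuous_measurable_fun.
  exact: continuous_sin.
have mcos : measurable_fun setT (fun z : R * R => cos (z.1 - m)).
  apply: measurableT_comp mt; apply: continuous_measurable_fun.
  exact: continuous_cos.
apply: measurable_funM.
  apply: measurable_funM; first apply: measurable_funM => //.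
  - by apply: measurable_funD => //; apply: measurable_funM.
  - by apply: mpow; exact: measurable_snd.
apply: measurableT_comp; first exact: measurable_expR.
apply: measurableT_comp => //; apply: measurable_funM.
  apply: mpow; apply: measurable_funM => //; exact: measurable_snd.
by apply: measurable_funB => //; apply: measurable_funM.
Qed.

Lemma continuous_f_AL eta t x : Gamma_AL eta -> 0 < x ->
  {for (t, x), continuous (fun z : R * R => f_AL eta z.1 z.2)}.
Proof.
case: eta => a b m k l [/= a0 b0 _ _ _] x0.
have ct : {for (t, x), continuous (fun z : R * R => z.1 - m)}.
  by apply: continuousB; [exact: cvg_fst|exact: cvg_cst].
have csin : {for (t, x), continuous (fun z : R * R => sin (z.1 - m))}.
  apply: (@continuous_comp _ _ _ (fun z : R * R => z.1 - m) sin) => //.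
  exact: continuous_sin.
have ccos : {for (t, x), continuous (fun z : R * R => cos (z.1 - m))}.
  apply: (@continuous_comp _ _ _ (fun z : R * R => z.1 - m) cos) => //.
  exact: continuous_cos.
apply: continuousM; first apply: continuousM; first apply: continuousM.
- exact: cvg_cst.
- apply: continuousD; first exact: cvg_cst.
  by apply: continuousM => //; exact: cvg_cst.
- apply: (@continuous_comp _ _ _ (fun z : R * R => z.2) (fun y => y `^ (a - 1))).
    exact: cvg_snd.
  exact: continuous_powR.
- apply: (@continuous_comp _ _ _ (fun z : R * R =>
    - ((b * z.2) `^ a * (1 - tanh k * cos (z.1 - m)))) expR);
    last exact: continuous_expR.
  apply: continuousN; apply: continuousM.
    apply: (@continuous_comp _ _ _ (fun z : R * R => b * z.2) (fun y => y `^ a)).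
      by apply: continuousM; [exact: cvg_cst|exact: cvg_snd].
    by apply: continuous_powR; exact: mulr_gt0.
  apply: continuousB; first exact: cvg_cst.
  by apply: continuousM => //; exact: cvg_cst.
Qed.

(** The skewing factor is at most 2 and the exponential at most 1. *)
Lemma f_AL_le eta t x : Gamma_AL eta ->
  f_AL eta t x <=
  AL_alpha eta * AL_beta eta `^ AL_alpha eta / (2 * pi * cosh (AL_kappa eta)) * 2
  * x `^ (AL_alpha eta - 1).
Proof.
case: eta => a b m k l [/= a0 b0 _ k0 l1].
have c0 := f_AL_const_gt0 k a0 b0.
rewrite -[leRHS]mulr1; apply: ler_pM.
- apply: mulr_ge0; last exact: powR_ge0.
  by apply: mulr_ge0; [exact: ltW|exact: skewing_ge0].
- exact: expR_ge0.
- apply: ler_wpM2r; first exact: powR_ge0.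
  apply: ler_wpM2l; first exact: ltW.
  move: l1 => /andP[h1 h2]; have s1 := sin_geN1 (t - m); have s2 := sin_le1 (t - m).
  nra.
- rewrite -[leRHS]expR0 ler_expR oppr_le0; apply: mulr_ge0; first exact: powR_ge0.
  exact: (ltW (rate_gt0 _ k0)).
Qed.

(** The only singularity is that of x^(alpha - 1) at 0, which is integrable
    because alpha > 0; the angle contributes the length of the circle. *)
Lemma cyl_cdf_AL_lty eta t y : Gamma_AL eta -> (cyl_cdf (f_AL eta) t y < +oo)%E.
Proof.
move=> G; have [a0 b0 _ k0 _] := G.
set a := AL_alpha eta in a0 *.
pose C := a * AL_beta eta `^ a / (2 * pi * cosh (AL_kappa eta)) * 2.
have C0 : 0 <= C by rewrite mulr_ge0// ltW// f_AL_const_gt0.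
pose y' := Num.max y 1.
have y'0 : 0 < y' by rewrite lt_max ltr01 orbT.
pose S := `[- pi, pi[%classic : set R.
pose T := `[0, y']%classic : set R.
have mp : measurable_fun setT (fun x : R => x `^ (a - 1)) := measurable_powR _.
have mCp : measurable_fun setT (fun x : R => (C * x `^ (a - 1))%:E).
  by apply/measurable_EFinP; exact: measurable_funM.
have Cp0 x : (0 <= (C * x `^ (a - 1))%:E)%E by rewrite lee_fin mulr_ge0 ?powR_ge0.
have mT : measurable T by exact: measurable_itv.
have mS : measurable S by exact: measurable_itv.
have mST : measurable (S `*` T) by exact: measurableX.
have QST : cylinder `&` `]-oo, t] `*` `]-oo, y] `<=` S `*` T.
  move=> [u v] [[/= uS + [_ /=]]]; rewrite !in_itv/= andbT => v0 vy.
  by split; rewrite //= /T/= in_itv/= v0 /y' le_max vy.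
apply: (@le_lt_trans _ _
  (\int[(@lebesgue_measure R \x @lebesgue_measure R)]_(z in S `*` T)
    (f_AL eta z.1 z.2)%:E)%E).
  apply: ge0_subset_integral => //.
  - by apply: measurableI; [exact: measurable_cylinder|exact: measurableX].
  - by apply/measurable_EFinP; exact: measurable_funTS (measurable_f_AL eta).
  - by move=> z _; rewrite lee_fin f_AL_ge0.
apply: (@le_lt_trans _ _
  (\int[(@lebesgue_measure R \x @lebesgue_measure R)]_(z in S `*` T)
    (C * z.2 `^ (a - 1))%:E)%E).
  apply: ge0_le_integral => //.
  - by move=> z _; rewrite lee_fin f_AL_ge0.
  - by apply/measurable_EFinP; exact: measurable_funTS (measurable_f_AL eta).
  - by apply: measurable_funTS; exact: (measurableT_comp mCp measurable_snd).
  - by move=> z _; rewrite lee_fin; exact: f_AL_le.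
rewrite [ltLHS](_ : _ = @lebesgue_measure R S *
    \int[@lebesgue_measure R]_(x in T) (C * x `^ (a - 1))%:E)%E; last first.
  apply: (@integral_setX_snd _ _ _ _ _ lebesgue_measure lebesgue_measure
    S T (fun x : R => (C * x `^ (a - 1))%:E)) => //.
  exact: measurable_funTS mCp.
under eq_integral do rewrite EFinM.
rewrite ge0_integralZl//; last 2 first.
- by apply/measurable_EFinP; exact: measurable_funTS.
- by move=> x _; rewrite lee_fin powR_ge0.
have := integral_powR_lty a0 y'0; rewrite -/T.
rewrite -ge0_fin_numE; last by apply: integral_ge0 => x _; rewrite lee_fin powR_ge0.
move=> /fineK <-; rewrite -EFinM /S lebesgue_measure_itv/=.
by case: ifP => _; rewrite -?EFinD -?EFinM ?mul0e ltry.
Qed.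

Lemma f_AL_cyl_density eta : Gamma_AL eta -> cyl_density (f_AL eta).
Proof.
move=> G; split; first exact: measurable_f_AL.
- by move=> u v _; exact: f_AL_ge0.
- by move=> u v; exact: cyl_cdf_AL_lty.
Qed.

End AL_density.

(** * Recovering the parameters *)

Section AL_parameters.
Context {R : realType}.
Implicit Types (eta : AL_param R).

Lemma f_AL_periodic eta t x : f_AL eta (t + pi *+ 2) x = f_AL eta t x.
Proof. by case: eta => a b m k l /=; rewrite addrAC sinD2pi cosD2pi. Qed.

(** At a fixed angle the density is a multiple of a Weibull density in x; the
    multiple and the rate carry all the dependence on the angle. *)
Lemma f_AL_weibull (a b m k l t x : R) : 0 < b -> 0 < x ->
  f_AL (ALParam a b m k l) t x =
  a * b `^ a / (2 * pi * cosh k) * (1 + l * sin (t - m)) * x `^ (a - 1)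
  * expR (- (b `^ a * (1 - tanh k * cos (t - m)) * x `^ a)).
Proof.
move=> b0 x0 /=; rewrite powRM ?ltW//; congr (_ * expR (- _)); ring.
Qed.

(** An angle at which the first density does not vanish is one at which the
    second does not vanish either, so weibull_inj applies there. *)
Lemma AL_fibre (a1 b1 m1 k1 l1 a2 b2 m2 k2 l2 t : R) :
    Gamma_AL (ALParam a1 b1 m1 k1 l1) -> Gamma_AL (ALParam a2 b2 m2 k2 l2) ->
    0 < 1 + l1 * sin (t - m1) ->
    (forall x, 0 < x -> f_AL (ALParam a1 b1 m1 k1 l1) t x =
                        f_AL (ALParam a2 b2 m2 k2 l2) t x) ->
  [/\ a1 = a2,
      a1 * b1 `^ a1 / (2 * pi * cosh k1) * (1 + l1 * sin (t - m1)) =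
      a2 * b2 `^ a2 / (2 * pi * cosh k2) * (1 + l2 * sin (t - m2)) &
      b1 `^ a1 * (1 - tanh k1 * cos (t - m1)) =
      b2 `^ a2 * (1 - tanh k2 * cos (t - m2))].
Proof.
move=> [/= a10 b10 _ k10 l1P] [/= a20 b20 _ k20 l2P] s1 E.
have c1 := f_AL_const_gt0 k1 a10 b10; have c2 := f_AL_const_gt0 k2 a20 b20.
have E' x : 0 < x -> _ := fun hx =>
  etrans (esym (f_AL_weibull a1 m1 k1 l1 t b10 hx))
  (etrans (E x hx) (f_AL_weibull a2 m2 k2 l2 t b20 hx)).
have A1 := mulr_gt0 c1 s1.
apply: (weibull_inj _ _ _ _ E') => //.
apply: mulr_gt0 => //; rewrite lt_neqAle skewing_ge0// andbT; apply/eqP => s2.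
have := E' 1 ltr01; rewrite -s2 mulr0 !mul0r !powR1 !mulr1 => /eqP.
by rewrite mulf_eq0 (gt_eqF A1) (gt_eqF (expR_gt0 _)).
Qed.

(** Put p := theta - mu1 and d := mu1 - mu2.  The rates at p = 0 and p = pi give
    beta1^alpha1 = beta2^alpha2 and tanh kappa1 = tanh kappa2 * cos d, hence
    cos d > 0; the rate at one of p = pi / 2, - pi / 2 gives sin d = 0.  So d = 0,
    which settles mu, kappa and beta, and the leading constant at the last angle
    gives lambda.  The skewing factor is 1 at p = 0 and p = pi, and it vanishes at
    most at one of p = pi / 2, - pi / 2. *)
Lemma AL_param_eq eta1 eta2 : Gamma_AL eta1 -> Gamma_AL eta2 ->
    (forall t x, - pi <= t < pi -> 0 < x -> f_AL eta1 t x = f_AL eta2 t x) ->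
  eta1 = eta2.
Proof.
case: eta1 => a1 b1 m1 k1 l1; case: eta2 => a2 b2 m2 k2 l2 G1 G2 E.
have pi0 := pi_gt0 R.
have [/= a10 b10 /andP[m10 m1pi] k10 l1P] := G1.
have [/= a20 b20 /andP[m20 m2pi] k20 l2P] := G2.
pose d := m1 - m2.
have fibre p : - (pi / 2) <= p <= pi -> 0 < 1 + l1 * sin p ->
  [/\ a1 = a2,
      a1 * b1 `^ a1 / (2 * pi * cosh k1) * (1 + l1 * sin p) =
      a2 * b2 `^ a2 / (2 * pi * cosh k2) * (1 + l2 * sin (p + d)) &
      b1 `^ a1 * (1 - tanh k1 * cos p) = b2 `^ a2 * (1 - tanh k2 * cos (p + d))].
  move=> /andP[p1 p2] s1.
  have m1E : m1 + p - m1 = p by ring.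
  have m2E : m1 + p - m2 = p + d by rewrite /d; ring.
  rewrite -m2E -{1 3}m1E; apply: (AL_fibre G1 G2) => [|x x0]; first by rewrite m1E.
  apply: (@eq_shifted_period _ (fun t => f_AL _ t x) (fun t => f_AL _ t x)).
  - by move=> t; exact: f_AL_periodic.
  - by move=> t; exact: f_AL_periodic.
  - by move=> t tpi; exact: E.
  - by apply/andP; split; lra.
have [|| aE _ R0] := fibre 0; [by apply/andP; split; lra|by rewrite sin0; lra|].
have [|| _ _ Rpi] := fibre pi; [by apply/andP; split; lra|by rewrite sinpi; lra|].
have B2 := powR_gt0 a2 b20.
have t1 := tanh_gt0 k10.
have t2 := tanh_gt0 k20.
rewrite add0r cos0 mulr1 in R0.
rewrite (addrC pi) cosDpi cospi in Rpi.
have BE : b1 `^ a1 = b2 `^ a2 by lra.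
have cosE : tanh k1 = tanh k2 * cos d.
  by apply: (mulfI (lt0r_neq0 B2)); rewrite BE in R0; lra.
have cosd : 0 < cos d by rewrite -(pmulr_rgt0 _ t2) -cosE.
(* the sign s is that of lambda1, which keeps the skewing factor >= 1 *)
have [s [sP sE s1]] : exists s : R, [/\ s = 1 \/ s = -1, 0 < 1 + l1 * s &
   - (pi / 2) <= s * (pi / 2) <= pi].
  have [l10|l10] := leP 0 l1; [exists 1|exists (-1)].
    by split; [left|lra|apply/andP; split; lra].
  by split; [right|lra|apply/andP; split; lra].
have sins : sin (s * (pi / 2)) = s.
  by case: sP => ->; rewrite ?mul1r ?mulN1r ?sinN sin_pihalf.
have coss : cos (s * (pi / 2)) = 0.
  by case: sP => ->; rewrite ?mul1r ?mulN1r ?cosN cos_pihalf.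
have [||_ Cs Rs] := fibre (s * (pi / 2)); [by []|by rewrite sins|].
rewrite cosD coss sins mul0r mulr0 subr0 mulr1 sub0r BE in Rs.
have sind : sin d = 0.
  have : b2 `^ a2 * tanh k2 * (s * sin d) = 0 by lra.
  move/eqP; rewrite mulf_eq0 (gt_eqF (mulr_gt0 B2 t2)) /= mulf_eq0.
  move=> /orP[/eqP s0|/eqP //].
  by case: sP; rewrite s0; lra.
have d0 : d = 0 by apply: angle_eq0 => //; apply/andP; split; rewrite /d; lra.
have kE : k1 = k2 by apply: tanh_inj; rewrite cosE d0 cos0 mulr1.
have mE : m1 = m2 by rewrite /d in d0; lra.
move: BE; rewrite -aE => BE.
have bE : b1 = b2 by apply: (powR_injective a10) => //; rewrite nnegrE ltW.
move: Cs; rewrite d0 addr0 sins -aE -bE -kE.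
move=> /(mulfI (lt0r_neq0 (f_AL_const_gt0 k1 a10 b10)))/addrI/mulIf.
have s0 : s != 0 by case: sP => ->; rewrite ?oppr_eq0 oner_eq0.
by move=> /(_ s0) lE; congr ALParam.
Qed.

End AL_parameters.

Theorem proposition6 (R : realType) : identifiable (@Gamma_AL R) (@f_AL R).
Proof.
move=> eta1 eta2 G1 G2 neq cdfE; apply: neq; apply: AL_param_eq => // t x tpi x0.
by apply: cdf_density_eq cdfE => //;
  [exact: f_AL_cyl_density|exact: f_AL_cyl_density
  |exact: continuous_f_AL|exact: continuous_f_AL].
Qed.
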